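(* Consider an instance of the two-machine flow shop problem $F2\,||\,C_{\max}$ with jobs indexed $1,\dots,n$ according to Johnson's sequence, with $B=\{n_A+1,\dots,n\}$ nonempty. Suppose that $P_{2B}\le P_{1B}-p^{\max}_{B2}$. Let $k_B\in\{n_A+1,\dots,n\}$ be the largest index in $B$ such that $$\sum_{i\in B:\ p_{2,i}\le p_{2,k_B}} p_{2,i}\ \le\ \sum_{i\in B:\ p_{2,i}\le p_{2,k_B}} p_{1,i}\;-\;p^{\max}_{B2}\qquad\text{and}\qquad p_{2,k_B}<p_{2,k_B-1},$$ where the second condition is regarded as satisfied if $k_B=n_A+1$. Then, for the job set $B$ (that is, for the instance of $F2\,||\,C_{\max}$ consisting of the jobs of $B$ only), sequencing jobs $n_A+1,\dots,k_B-1$ in any order, followed by jobs $k_B,\dots,n$ in this (Johnson's) order, gives an optimal schedule.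
   Context: Two-machine flow shop $F2\,||\,C_{\max}$: a finite set of jobs must be processed first on machine $M_1$ and then on machine $M_2$; job $j$ requires processing time $p_{1,j}\ge 0$ on $M_1$ and $p_{2,j}\ge 0$ on $M_2$. All jobs are available at time $0$, each machine processes at most one job at a time, preemption is not allowed, and a job can start on $M_2$ only after completing on $M_1$. The goal is to minimize the makespan $C_{\max}$, i.e. the latest completion time on $M_2$. A sequence (permutation) of the jobs defines the permutation schedule in which both machines process the jobs in that order, each operation starting as early as possible. A schedule is optimal if its makespan is minimum among all feasible schedules (it is well known that some permutation schedule attains this minimum). Johnson's sequence: $A$ is the set of jobs with $p_{1,j}\le p_{2,j}$ and $B$ the set of jobs with $p_{1,j}>p_{2,j}$; first come the jobs of $A$ in nondecreasing order of $p_{1,j}$, then the jobs of $B$ in nonincreasing order of $p_{2,j}$ (ties broken arbitrarily). Jobs are indexed so that Johnson's sequence is $1,2,\dots,n$, with $A=\{1,\dots,n_A\}$ and $B=\{n_A+1,\dots,n\}$. Notation: $P_{1B}=\sum_{i\in B}p_{1,i}$, $P_{2B}=\sum_{i\in B}p_{2,i}$, $p^{\max}_{B2}=\max_{i\in B}p_{2,i}$. *)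

(* Defs.v *)
From mathcomp Require Import all_boot all_order all_algebra.
Set Implicit Arguments.
Unset Strict Implicit.
Unset Printing Implicit Defensive.
Import Order.TTheory GRing.Theory Num.Theory.
Local Open Scope ring_scope.

(* F2 || C_max on a job set J : {set T}; p1 and p2 are the processing times on
   the two machines. Data attached to jobs outside J is irrelevant. *)
Section FlowShop.
Variables (R : realFieldType) (T : finType).
Implicit Types (p start : T -> R) (J : {set T}).

Record schedule := Schedule { start1 : T -> R; start2 : T -> R }.

(* Without preemption, job j occupies the machine during the half-open interval
   [start j, start j + p j), which is empty when p j = 0. *)
Definition busy p start (j : T) (t : R) : Prop :=
  start j <= t /\ t < start j + p j.

Definition one_job_at_a_time p start J : Prop :=
  forall i j t, i \in J -> j \in J ->
    busy p start i t -> busy p start j t -> i = j.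

Definition feasible p1 p2 J (S : schedule) : Prop :=
  [/\ forall j, j \in J -> 0 <= start1 S j,
      one_job_at_a_time p1 (start1 S) J,
      one_job_at_a_time p2 (start2 S) J
    & forall j, j \in J -> start1 S j + p1 j <= start2 S j].

(* Completion times of feasible schedules are nonnegative when the processing
   times are, so the default value 0 is harmless. *)
Definition makespan p2 J (S : schedule) : R :=
  \big[Num.max/0]_(j in J) (start2 S j + p2 j).

Definition optimal p1 p2 J (S : schedule) : Prop :=
  feasible p1 p2 J S /\
  forall S', feasible p1 p2 J S' -> makespan p2 J S <= makespan p2 J S'.

(* Start times of job i on both machines when the jobs of s are processed in
   this order, each operation as early as possible, M1 being available from t1
   and M2 from t2; the value is (0, 0) if i does not occur in s. *)
Fixpoint earliest_starts p1 p2 (t1 t2 : R) (s : seq T) (i : T) : R * R :=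
  if s is j :: s' then
    let c1 := t1 + p1 j in
    let b2 := Num.max c1 t2 in
    if i == j then (t1, b2) else earliest_starts p1 p2 c1 (b2 + p2 j) s' i
  else (0, 0).

Definition perm_schedule p1 p2 (s : seq T) : schedule :=
  Schedule (fun i => (earliest_starts p1 p2 0 0 s i).1)
           (fun i => (earliest_starts p1 p2 0 0 s i).2).

Definition jobsA p1 p2 : {set T} := [set j | p1 j <= p2 j].
Definition jobsB p1 p2 : {set T} := [set j | p1 j > p2 j].

End FlowShop.

Section Johnson.
Variables (R : realFieldType) (n : nat).
Implicit Types p : 'I_n -> R.

(* 0, 1, ..., n-1 is a Johnson sequence, in which the first nA jobs form A;
   indices are shifted by one from 1, ..., n, so that B starts at index nA. *)
Definition johnson_indexed (nA : nat) p1 p2 : Prop :=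
  [/\ (nA <= n)%N,
      jobsA p1 p2 = [set i : 'I_n | (i < nA)%N],
      jobsB p1 p2 = [set i : 'I_n | (nA <= i)%N],
      {in jobsA p1 p2 &, forall i j : 'I_n, (i <= j)%N -> p1 i <= p1 j}
    & {in jobsB p1 p2 &, forall i j : 'I_n, (i <= j)%N -> p2 j <= p2 i}].

Definition sumB p1 p2 (p : 'I_n -> R) : R := \sum_(i in jobsB p1 p2) p i.

Definition pmaxB2 p1 p2 : R := \big[Num.max/0]_(i in jobsB p1 p2) p2 i.

Definition kB_condition (nA : nat) p1 p2 (k : 'I_n) : Prop :=
  [/\ k \in jobsB p1 p2,
      \sum_(i in jobsB p1 p2 | p2 i <= p2 k) p2 i <=
      \sum_(i in jobsB p1 p2 | p2 i <= p2 k) p1 i - pmaxB2 p1 p2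
    & k = nA :> nat \/ (forall j : 'I_n, j.+1 = k :> nat -> p2 k < p2 j)].

Definition is_kB (nA : nat) p1 p2 (k : 'I_n) : Prop :=
  kB_condition nA p1 p2 k /\
  forall k' : 'I_n, kB_condition nA p1 p2 k' -> (k' <= k)%N.

End Johnson.

(* Main.v *)
Require Import Defs.
From mathcomp Require Import all_boot all_order all_algebra.
From mathcomp Require Import lra.
Set Implicit Arguments.
Unset Strict Implicit.
Unset Printing Implicit Defensive.
Import Order.TTheory GRing.Theory Num.Theory.
Local Open Scope ring_scope.

(** The makespan of a permutation schedule is the length of its longest
    critical path: a job [u] is chosen where the path leaves [M1] for [M2], and
    the path consists of the [M1] operations up to and including [u] and the
    [M2] operations from [u] on. Only the upper bound is used here
    ([perm_schedule_makespan_le]). So it suffices to show that every critical path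
    of the proposed sequence is at most the makespan of an arbitrary feasible
    schedule [S] of the jobs of B. There are two cases.

    If [u] comes before [kB], the rest of the path on [M2] is short: the jobs
    after [u] among the freely ordered ones take at most as long on [M2] as on
    [M1],
    [u] itself takes at most [pmaxB2] on [M2], and the inequality defining [kB]
    says that the total [M2] time of the jobs from [kB] on is below their total
    [M1] time by at least [pmaxB2]. Hence the path has length at most the total
    [M1] load of B, which is a lower bound for any schedule.

    If [u] is [kB] or comes after it, all jobs sequenced before [u] have a
    smaller index, hence an [M2] time at least that of [u], whatever the order
    chosen for the first jobs. The path through [u] is then itself a lower bound
    for all schedules ([path_le_makespan]). Indeed, let X be the jobs up to [u],
    Y the others, and [x] the job of X that is completed last on [M1], at time
    [c]. By time [c], [M1] has processed X and some jobs Y1 of Y; after [c],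
    [M2] still has to process [x] and the remaining jobs of Y. The makespan is
    thus at least p1(X) + p1(Y1) + p2(x) + p2(Y \ Y1), and p2 <= p1 on Y1 and
    p2(u) <= p2(x) turn this into the length of the path ([makespan_ge]). *)

(** * Lower bounds valid for all feasible schedules *)

Section FlowShopBounds.
Variables (R : realFieldType) (T : finType).
Implicit Types (p start : T -> R) (J K X Y : {set T}) (S : schedule R T).

Lemma one_job_at_a_timeS p start J K :
  K \subset J -> one_job_at_a_time p start J -> one_job_at_a_time p start K.
Proof.
move=> /subsetP KJ one i j t iK jK.
by apply: one; apply: KJ.
Qed.

(** By induction on the job that starts last: the others are completed when it
    starts, so they fit between [a] and its start. This needs a positive length,
    since an operation of length zero may be placed inside another one; a job
    of length zero is discarded with [b] kept. *)
Lemma machine_capacity p start K (a b : R) :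
  (forall i, 0 <= p i) -> one_job_at_a_time p start K -> a <= b ->
  (forall i, i \in K -> a <= start i) ->
  (forall i, i \in K -> start i + p i <= b) ->
  a + \sum_(i in K) p i <= b.
Proof.
move=> p_ge0; have [m] := ubnP #|K|.
elim: m K b => // m IHm K b cardK one le_ab aK Kb.
have [->|[j0 j0K]] := set_0Vmem K; first by rewrite big_set0 addr0.
case: (arg_maxP start j0K) => j jK0 j_last; have {jK0} jK : j \in K := jK0.
have sub := subsetDl K [set j].
have inK i : i \in K :\ j -> i \in K by apply: (subsetP sub).
have ltm : (#|K :\ j| < m)%N by rewrite (cardsD1 j K) jK in cardK.
rewrite (big_setD1 j) //=.
have [pj0|pj_gt0] := leP (p j) 0.
  have -> : p j = 0 by apply: le_anti; rewrite pj0 p_ge0.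
  rewrite add0r; apply: IHm => //; first exact: one_job_at_a_timeS one.
    by move=> i /inK; apply: aK.
  by move=> i /inK; apply: Kb.
have: a + \sum_(i in K :\ j) p i <= start j.
  apply: IHm => //; first exact: one_job_at_a_timeS one.
  - exact: aK.
  - by move=> i /inK; apply: aK.
  - move=> i iKj; have iK := inK i iKj.
    rewrite leNgt; apply/negP => overlap.
    have eq_ij : i = j.
      apply: (one i j (start j)) => //; split; rewrite ?ltrDl //.
      exact: j_last.
    by rewrite eq_ij !inE eqxx in iKj.
have := Kb j jK; lra.
Qed.

Lemma le_makespan p2 J S j : j \in J -> start2 S j + p2 j <= makespan p2 J S.
Proof. by move=> jJ; rewrite /makespan (bigD1 j) //= le_max lexx. Qed.

(** When the last job of X leaves [M1], everything of X and part of Y has been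
    through [M1], while that job and the rest of Y have still to go through
    [M2]. *)
Lemma makespan_ge p1 p2 J S X Y (q : R) :
  (forall i, 0 <= p1 i) -> (forall i, 0 <= p2 i) -> feasible p1 p2 J S ->
  X \subset J -> Y \subset J -> [disjoint X & Y] -> X != set0 ->
  (forall i, i \in X -> q <= p2 i) -> (forall i, i \in Y -> p2 i <= p1 i) ->
  \sum_(i in X) p1 i + q + \sum_(i in Y) p2 i <= makespan p2 J S.
Proof.
move=> p1_ge0 p2_ge0 [start_ge0 one1 one2 flow] XJ YJ XY.
case/set0Pn => x0 x0X qX Yle.
pose C1 i := start1 S i + p1 i.
case: (arg_maxP C1 x0X) => x xX0 x_last; have {xX0} xX : x \in X := xX0.
have inJX i : i \in X -> i \in J := subsetP XJ i.
have inJY i : i \in Y -> i \in J := subsetP YJ i.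
pose early := [set i in Y | C1 i <= C1 x]; pose late := Y :\: early.
have earlyY : early \subset Y by apply/subsetP => i; rewrite inE => /andP[].
have sumY : \sum_(i in Y) p2 i =
    \sum_(i in early) p2 i + \sum_(i in late) p2 i.
  by rewrite (big_setID early) /= (setIidPr earlyY).
have sum_early : \sum_(i in early) p2 i <= \sum_(i in early) p1 i.
  by apply: ler_sum => i /(subsetP earlyY); apply: Yle.
have M1_load : 0 + \sum_(i in X :|: early) p1 i <= C1 x.
  apply: (@machine_capacity p1 (start1 S)) => //.
  - apply: one_job_at_a_timeS one1; rewrite subUset XJ.
    exact: subset_trans YJ.
  - by rewrite addr_ge0 // start_ge0 // inJX.
  - move=> i /setUP[/inJX|/(subsetP earlyY)/inJY]; exact: start_ge0.
  - move=> i /setUP[|]; first exact: x_last.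
    by rewrite inE => /andP[].
have x_notlate : x \notin late.
  by rewrite inE (disjointFr XY xX) andbF.
have M2_load : C1 x + \sum_(i in x |: late) p2 i <= makespan p2 J S.
  have inJ i : i \in x |: late -> i \in J.
    by case/setU1P => [->|/setDP[/inJY]//]; apply: inJX.
  apply: (@machine_capacity p2 (start2 S)) => //.
  - by apply: one_job_at_a_timeS one2; apply/subsetP.
  - apply: le_trans (le_makespan p2 S (inJX x xX)).
    by apply: le_trans (flow x (inJX x xX)) _; rewrite lerDl.
  - move=> i iL; apply: le_trans (flow i (inJ i iL)).
    case/setU1P: iL => [->|/setDP[iY]]; first exact: lexx.
    by rewrite inE iY /= -ltNge => /ltW.
  - by move=> i /inJ; apply: le_makespan.
have sum_Xearly :
    \sum_(i in X :|: early) p1 i = \sum_(i in X) p1 i + \sum_(i in early) p1 i.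
  rewrite -bigU; last exact: disjointWr earlyY XY.
  by apply: eq_bigl => i; rewrite !inE.
move: M1_load M2_load; rewrite big_setU1 //= sum_Xearly.
have := qX x xX; rewrite sumY; lra.
Qed.

(** The critical path through [u] depends on the sequence only through the set
    of jobs on either side of [u]; a minimal [p2] at [u] among the jobs up to it
    makes it a bound for all schedules. *)
Lemma path_le_makespan p1 p2 J S l u r :
  (forall i, 0 <= p1 i) -> (forall i, 0 <= p2 i) -> feasible p1 p2 J S ->
  uniq (l ++ u :: r) -> {subset l ++ u :: r <= J} ->
  {in J, forall i, p2 i <= p1 i} -> {in l, forall i, p2 u <= p2 i} ->
  \sum_(i <- l) p1 i + p1 u + (p2 u + \sum_(i <- r) p2 i) <= makespan p2 J S.
Proof.
move=> p1_ge0 p2_ge0 feas; rewrite -cat_rcons cat_uniq => /and3P[uX dXY uY].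
move=> subJ leJ le_u.
have sumX : \sum_(i in [set i in rcons l u]) p1 i = \sum_(i <- l) p1 i + p1 u.
  rewrite (eq_bigl [in rcons l u]); last by move=> i; rewrite inE.
  by rewrite -big_uniq //= -cats1 big_cat big_seq1.
have sumY : \sum_(i in [set i in r]) p2 i = \sum_(i <- r) p2 i.
  rewrite (eq_bigl [in r]); last by move=> i; rewrite inE.
  by rewrite -big_uniq.
rewrite -sumX -sumY addrA; apply: makespan_ge feas _ _ _ _ _ _ => //.
- by apply/subsetP=> i; rewrite inE => ?; rewrite subJ // mem_cat; apply/orP; left.
- by apply/subsetP=> i; rewrite inE => ?; rewrite subJ // mem_cat; apply/orP; right.
- apply/pred0P => i /=; rewrite !inE; apply/negP => /andP[iX iY].
  by case/hasP: dXY; exists i.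
- by apply/set0Pn; exists u; rewrite inE mem_rcons mem_head.
- by move=> i; rewrite inE mem_rcons inE => /predU1P[->//|/le_u].
- by move=> i; rewrite inE => ir; rewrite leJ // subJ // mem_cat ir orbT.
Qed.

(** * Permutation schedules and critical paths *)

Lemma earliest_starts_ge p1 p2 t1 t2 s i :
  (forall i, 0 <= p1 i) -> (forall i, 0 <= p2 i) -> i \in s ->
  let e := earliest_starts p1 p2 t1 t2 s i in
  [/\ t1 <= e.1, t2 <= e.2 & e.1 + p1 i <= e.2].
Proof.
move=> p1_ge0 p2_ge0; elim: s t1 t2 => //= j s IHs t1 t2.
rewrite inE; have [->|_] /= := eqVneq i j.
  by rewrite !le_max !lexx orbT.
case/(IHs (t1 + p1 j) (Num.max (t1 + p1 j) t2 + p2 j)) => le1 le2 flow.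
split=> //; first by apply: le_trans le1; rewrite lerDl.
by apply: le_trans le2; rewrite ler_wpDr // le_max lexx orbT.
Qed.

Lemma earliest_starts_one_job p1 p2 t1 t2 s J :
  (forall i, 0 <= p1 i) -> (forall i, 0 <= p2 i) -> {subset J <= s} ->
  one_job_at_a_time p1 (fun i => (earliest_starts p1 p2 t1 t2 s i).1) J /\
  one_job_at_a_time p2 (fun i => (earliest_starts p1 p2 t1 t2 s i).2) J.
Proof.
move=> p1_ge0 p2_ge0 Js.
suff one i k t : i \in s -> k \in s ->
  (busy p1 (fun i => (earliest_starts p1 p2 t1 t2 s i).1) i t ->
   busy p1 (fun i => (earliest_starts p1 p2 t1 t2 s i).1) k t -> i = k) /\
  (busy p2 (fun i => (earliest_starts p1 p2 t1 t2 s i).2) i t ->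
   busy p2 (fun i => (earliest_starts p1 p2 t1 t2 s i).2) k t -> i = k).
  by split=> i k t /Js iJ /Js kJ; case: (one i k t iJ kJ).
rewrite /busy; elim: s t1 t2 {J Js} => //= j s IHs t1 t2.
set c1 := t1 + p1 j; set c2 := _ + p2 j.
rewrite !inE; have [->|ij] /= := eqVneq i j; have [->|kj] //= := eqVneq k j.
- move=> _ /(earliest_starts_ge c1 c2 p1_ge0 p2_ge0)[le1 le2 _].
  split=> -[_ lt_t] [le_t _]; exfalso.
    by have := le_lt_trans (le_trans le1 le_t) lt_t; rewrite ltxx.
  by have := le_lt_trans (le_trans le2 le_t) lt_t; rewrite ltxx.
- move=> /(earliest_starts_ge c1 c2 p1_ge0 p2_ge0)[le1 le2 _] _.
  split=> -[le_t _] [_ lt_t]; exfalso.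
    by have := le_lt_trans (le_trans le1 le_t) lt_t; rewrite ltxx.
  by have := le_lt_trans (le_trans le2 le_t) lt_t; rewrite ltxx.
exact: IHs.
Qed.

Lemma perm_schedule_feasible p1 p2 J s :
  (forall i, 0 <= p1 i) -> (forall i, 0 <= p2 i) -> {subset J <= s} ->
  feasible p1 p2 J (perm_schedule p1 p2 s).
Proof.
move=> p1_ge0 p2_ge0 Js.
have [one1 one2] := earliest_starts_one_job 0 0 p1_ge0 p2_ge0 Js.
by split=> // j /Js /(earliest_starts_ge 0 0 p1_ge0 p2_ge0)[].
Qed.

(** [M2] is released after the whole sequence either by a path that switches
    machines at some job, or by one that stays on [M2] from its initial release
    time [t2]; the second kind is needed for the induction, in which both
    release times advance. *)
Lemma earliest_completion_le p1 p2 t1 t2 s (M : R) :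
  (forall i, 0 <= p2 i) ->
  (forall l u r, s = l ++ u :: r ->
     t1 + \sum_(i <- l) p1 i + p1 u + (p2 u + \sum_(i <- r) p2 i) <= M) ->
  t2 + \sum_(i <- s) p2 i <= M ->
  forall i, i \in s -> (earliest_starts p1 p2 t1 t2 s i).2 + p2 i <= M.
Proof.
move=> p2_ge0; elim: s t1 t2 => //= j s IHs t1 t2 paths load2 i.
have load1 := paths [::] j s erefl; rewrite big_nil addr0 in load1.
rewrite big_cons in load2.
have rest_ge0 : 0 <= \sum_(k <- s) p2 k by apply: sumr_ge0.
have b2_le : Num.max (t1 + p1 j) t2 + p2 j + \sum_(k <- s) p2 k <= M.
  by rewrite -addrA maxEle; case: ifP.
rewrite inE; have [->|_] /= := eqVneq i j; first by lra.
apply: IHs => // l u r def_s.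
have := paths (j :: l) u r; rewrite def_s big_cons => /(_ erefl); lra.
Qed.

Lemma perm_schedule_makespan_le p1 p2 J s (M : R) :
  (forall i, 0 <= p2 i) -> {subset J <= s} -> 0 <= M ->
  (forall l u r, s = l ++ u :: r ->
     \sum_(i <- l) p1 i + p1 u + (p2 u + \sum_(i <- r) p2 i) <= M) ->
  \sum_(i <- s) p2 i <= M ->
  makespan p2 J (perm_schedule p1 p2 s) <= M.
Proof.
move=> p2_ge0 Js M_ge0 paths load2; apply: bigmax_le => // i /Js.
apply: earliest_completion_le => //; last by rewrite add0r.
by move=> l u r /paths; rewrite add0r.
Qed.

End FlowShopBounds.

(** * The jobs of B in Johnson's order *)

Section Johnson.
Variables (R : realFieldType) (n nA : nat) (p1 p2 : 'I_n -> R).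
Hypothesis johnson : johnson_indexed nA p1 p2.

Lemma in_jobsB (i : 'I_n) : (i \in jobsB p1 p2) = (nA <= i)%N.
Proof. by case: johnson => _ _ -> _ _; rewrite inE. Qed.

Lemma johnson_jobsB_le (i j : 'I_n) : (nA <= i <= j)%N -> p2 j <= p2 i.
Proof.
case/andP=> nAi ij; case: johnson => _ _ _ _ le2; apply: le2 => //.
  by rewrite in_jobsB.
by rewrite in_jobsB (leq_trans nAi).
Qed.

(** The strict drop of [p2] just before [k], if [k] is not the first job of B,
    rules out ties with earlier jobs, so the jobs of B with [p2] at most [p2 k] are exactly those from [k] on. *)
Lemma sum_kB_tail k (p : 'I_n -> R) : kB_condition nA p1 p2 k ->
  \sum_(i in jobsB p1 p2 | p2 i <= p2 k) p i =
  \sum_(i <- [seq i : 'I_n <- enum 'I_n | (k <= i)%N]) p i.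
Proof.
case=> kB _ drop; rewrite in_jobsB in kB.
rewrite big_filter big_enum_cond; apply: eq_bigl => i; rewrite in_jobsB /=.
have [ki|ik] := leqP k i.
  by rewrite (leq_trans kB ki) johnson_jobsB_le // kB.
apply/negP => /andP[nAi]; apply/negP; rewrite -ltNge.
case: drop => [k_nA|drop]; first by rewrite k_nA ltnNge nAi in ik.
have k_gt0 := leq_ltn_trans (leq0n i) ik.
have j_lt : (k.-1 < n)%N by rewrite (leq_ltn_trans (leq_pred k)).
apply: lt_le_trans (drop (Ordinal j_lt) (prednK k_gt0)) _.
by apply: johnson_jobsB_le; rewrite nAi /= -ltnS prednK.
Qed.

Lemma le_pmaxB2 (i : 'I_n) : (nA <= i)%N -> p2 i <= pmaxB2 p1 p2.
Proof. by move=> nAi; rewrite /pmaxB2 (bigD1 i) ?in_jobsB //= le_max lexx. Qed.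

End Johnson.

Lemma index_tail_prefix_le n k (l r : seq 'I_n) u :
  [seq i : 'I_n <- enum 'I_n | (k <= i)%N] = l ++ u :: r ->
  {in l, forall i : 'I_n, (i <= u)%N}.
Proof.
move=> def_t i il.
have : sorted (fun i j : 'I_n => (i < j)%N) (l ++ u :: r).
  rewrite -def_t; apply: sorted_filter.
    by move=> a b c; apply: ltn_trans.
  by have := iota_ltn_sorted 0 n; rewrite -val_enum_ord sorted_map.
rewrite sorted_pairwise; last by move=> a b c; apply: ltn_trans.
rewrite pairwise_cat => /andP[/allrelP lt_lr _].
by apply/ltnW/lt_lr; rewrite ?mem_head.
Qed.

(** * Optimality *)

Theorem mainTheorem2 (R : realFieldType) (n nA : nat) (p1 p2 : 'I_n -> R)
  (p1_ge0 : forall i, 0 <= p1 i) (p2_ge0 : forall i, 0 <= p2 i)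
  (johnson : johnson_indexed nA p1 p2)
  (B_neq0 : jobsB p1 p2 != set0)
  (P2B_le : sumB p1 p2 p2 <= sumB p1 p2 p1 - pmaxB2 p1 p2)
  (kB : 'I_n) (kB_def : is_kB nA p1 p2 kB)
  (s : seq 'I_n)
  (s_perm : perm_eq s [seq i : 'I_n <- enum 'I_n | (nA <= i < kB)%N]) :
  optimal p1 p2 (jobsB p1 p2)
    (perm_schedule p1 p2 (s ++ [seq i : 'I_n <- enum 'I_n | (kB <= i)%N])).
Proof.
case: kB_def => kB_cond _; have [kB_B tail_slack _] := kB_cond.
rewrite !(sum_kB_tail johnson _ kB_cond) in tail_slack.
rewrite (in_jobsB johnson) in kB_B.
set B := jobsB p1 p2 in B_neq0 *; set tail := filter _ _ in tail_slack *.
have inB i : (i \in B) = (nA <= i)%N by apply: in_jobsB.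
have in_s i : (i \in s) = (nA <= i < kB)%N.
  by rewrite (perm_mem s_perm) mem_filter mem_enum andbT.
have in_tail i : (i \in tail) = (kB <= i)%N.
  by rewrite mem_filter mem_enum andbT.
have mem_st i : (i \in s ++ tail) = (i \in B).
  rewrite mem_cat in_s in_tail inB; case: (leqP kB i) => [ki|_].
    by rewrite (leq_trans kB_B ki) orbT.
  by rewrite andbT orbF.
have uniq_st : uniq (s ++ tail).
  rewrite cat_uniq (perm_uniq s_perm) filter_uniq ?enum_uniq // andTb.
  apply/andP; split; last exact/filter_uniq/enum_uniq.
  apply/hasPn => i; rewrite in_tail in_s => ki.
  by rewrite negb_and -leqNgt ki orbT.
have le21 i : i \in B -> p2 i <= p1 i by rewrite inE => /ltW.
have Bst : {subset B <= s ++ tail} by move=> i; rewrite mem_st.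
split; first exact: perm_schedule_feasible.
move=> S feas.
have sum_st (p : 'I_n -> R) : \sum_(i <- s ++ tail) p i = \sum_(i in B) p i.
  by rewrite big_uniq //=; apply: eq_bigl.
(* The load of M1 is the bound makespan_ge for X = B, Y empty and q = 0. *)
have P1B_le : \sum_(i in B) p1 i <= makespan p2 B S.
  have := makespan_ge p1_ge0 p2_ge0 feas (subxx B) (sub0set B) _ B_neq0.
  move=> /(_ 0); rewrite big_set0 !addr0; apply=> [|//|i].
    by apply/pred0P => i; rewrite /= in_set0 andbF.
  by rewrite inE.
apply: perm_schedule_makespan_le => //.
- by apply: le_trans P1B_le; apply: sumr_ge0.
- move=> l u r def_st.
  have def_l : take (size l) (s ++ tail) = l by rewrite def_st take_size_cat.
  have def_ur : drop (size l) (s ++ tail) = u :: r.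
    by rewrite def_st drop_size_cat.
  move: def_l def_ur; rewrite take_cat drop_cat; case: ltnP => [l_s|s_l].
    (* The path leaves M1 at one of the freely ordered jobs. *)
    case def_ur': (drop (size l) s) => [|u' r'] def_l.
      by have := size_drop (size l) s; rewrite def_ur' /= => /eqP;
         rewrite eq_sym subn_eq0 leqNgt l_s.
    case=> eq_u def_r; rewrite {u'}eq_u in def_ur'.
    have def_s : s = l ++ u :: r'.
      by rewrite -{1}(cat_take_drop (size l) s) def_l def_ur'.
    have us : u \in s by rewrite def_s mem_cat mem_head orbT.
    have r'B : {in r', forall i, p2 i <= p1 i}.
      move=> i ir'; apply: le21; rewrite -mem_st mem_cat def_s mem_cat inE ir'.
      by rewrite !orbT.
    have le_r' : \sum_(i <- r') p2 i <= \sum_(i <- r') p1 i.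
      by rewrite big_seq [leRHS]big_seq; apply: ler_sum.
    have le_u : p2 u <= pmaxB2 p1 p2.
      by apply: (le_pmaxB2 johnson); move: us; rewrite in_s => /andP[].
    apply: le_trans P1B_le; rewrite -sum_st def_s -def_r !big_cat big_cons /=.
    lra.
  (* The path leaves M1 at kB or later. *)
  move=> def_l def_ur.
  have def_tail : tail = take (size l - size s) tail ++ u :: r.
    by rewrite -def_ur cat_take_drop.
  have u_ge : (kB <= u)%N by rewrite -in_tail def_tail mem_cat mem_head orbT.
  apply: (path_le_makespan p1_ge0 p2_ge0 feas); rewrite -?def_st //.
    by move=> i; rewrite mem_st.
  move=> i; rewrite -{1}def_l mem_cat => il.
  apply: (johnson_jobsB_le johnson); apply/andP; split.
    by rewrite -inB -mem_st def_st mem_cat -def_l mem_cat il.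
  case/orP: il => [|il].
    by rewrite in_s => /andP[_ /ltnW/leq_trans]; apply.
  exact: (index_tail_prefix_le def_tail).
- by rewrite sum_st; apply: le_trans P1B_le; apply: ler_sum.
Qed.
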